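(* Let $(X,d)$ be a complete metric space and $\mathcal{S}=(X,(\phi_j)_{j=1}^L,(p_j)_{j=1}^L)$ an IFS with probabilities consisting of Banach contractions, and let $\alpha_\mathcal{S}:=\max\{\mathrm{Lip}(\phi_j):j=1,\dots,L\}$. Let $\varepsilon>0$, $\hat{X}$ a proper $\varepsilon$-net of $X$, $r:X\to\hat{X}$ a Borel measurable $\varepsilon$-projection, and $\hat{\mathcal{S}}:=(\hat{X},(\hat\phi_j)_{j=1}^L,(p_j)_{j=1}^L)$ with $\hat\phi_j:=(r\circ\phi_j)|_{\hat{X}}$. Then for any $\nu\in\mathcal{P}(\hat{X})$ and $n\in\mathbb{N}$, $$d_{MK}\big(e^\sharp(M^n_{\hat{\mathcal{S}}}(\nu)),\mu_\mathcal{S}\big)\le\frac{\varepsilon}{1-\alpha_\mathcal{S}}+\alpha_\mathcal{S}^n\,d_{MK}(e^\sharp(\nu),\mu_\mathcal{S}),$$ where $\mu_\mathcal{S}$ is the Hutchinson measure of $\mathcal{S}$. In particular, there is $n_0\in\mathbb{N}$ such that for every $n\ge n_0$, $d_{MK}(e^\sharp(M^n_{\hat{\mathcal{S}}}(\nu)),\mu_\mathcal{S})\le\frac{2\varepsilon}{1-\alpha_\mathcal{S}}$.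
   Context: An IFS with probabilities is $(X,(\phi_j)_{j=1}^L,(p_j)_{j=1}^L)$ with continuous $\phi_j:X\to X$ and $p_j>0$, $\sum p_j=1$; a Banach contraction is a map with Lipschitz constant $<1$. $\mathcal{P}(Y)$: Borel probability measures on $Y$ with compact support. $w^\sharp\mu(B)=\mu(w^{-1}(B))$. The Markov operator is $M_\mathcal{S}(\mu)=\sum_j p_j\phi_j^\sharp\mu$ on $\mathcal{P}(X)$, and $M_{\hat{\mathcal{S}}}(\nu)=\sum_j p_j\hat\phi_j^\sharp\nu$ on $\mathcal{P}(\hat X)$. $d_{MK}(\mu,\nu)=\sup\{|\int f d\mu-\int f d\nu|:f:X\to\mathbb{R},\ \mathrm{Lip}(f)\le1\}$. The Hutchinson measure $\mu_\mathcal{S}$ is the unique $\mu_\mathcal{S}\in\mathcal{P}(X)$ with $M_\mathcal{S}(\mu_\mathcal{S})=\mu_\mathcal{S}$ (and $M^k_\mathcal{S}(\mu)\to\mu_\mathcal{S}$ in $d_{MK}$ for every $\mu$). $e:\hat X\to X$ is the inclusion, so $e^\sharp\nu(B)=\nu(B\cap\hat X)$. $\hat X$ is an $\varepsilon$-net if every $x\in X$ is within $\varepsilon$ of some point of $\hat X$; proper if $D\cap\hat X$ is finite for every bounded $D$. $r$ is an $\varepsilon$-projection if $r|_{\hat X}=\mathrm{id}$ and $d(x,r(x))\le\varepsilon$ for all $x$. *)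

(* Defs.v *)
From HB Require Import structures.
From mathcomp Require Import all_boot all_order all_algebra.
From mathcomp Require Import all_classical all_reals.
From mathcomp Require Import ereal topology normedtype sequences measure lebesgue_integral.

Set Implicit Arguments.
Unset Strict Implicit.
Unset Printing Implicit Defensive.

Import Order.TTheory GRing.Theory Num.Theory.
Local Open Scope classical_set_scope.
Local Open Scope ring_scope.

Section MetricDefs.
Context {R : realType} {T : Type} (d : T -> T -> R).

Definition is_metric : Prop :=
  [/\ (forall x y, 0 <= d x y),
      (forall x y, d x y = 0 <-> x = y),
      (forall x y, d x y = d y x) &
      (forall x y z, d x z <= d x y + d y z)].

Definition d_cauchy (u : nat -> T) : Prop :=
  forall eps : R, 0 < eps -> exists N : nat,
    forall m n : nat, (N <= m)%N -> (N <= n)%N -> d (u m) (u n) < eps.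

Definition d_converges (u : nat -> T) : Prop :=
  exists x : T, forall eps : R, 0 < eps -> exists N : nat,
    forall n : nat, (N <= n)%N -> d (u n) x < eps.

Definition d_complete : Prop := forall u, d_cauchy u -> d_converges u.

Definition dopen : set (set T) :=
  fun A => forall x, A x -> exists e : R, 0 < e /\ [set y | d x y < e] `<=` A.

Definition dcompact (K : set T) : Prop :=
  forall (I : Type) (U : I -> set T), (forall i, dopen (U i)) ->
    K `<=` \bigcup_i U i ->
    exists (n : nat) (g : nat -> I),
      K `<=` (fun x => exists2 k : nat, (k < n)%N & U (g k) x).

Definition dbounded (D : set T) : Prop :=
  exists (x0 : T) (rho : R), D `<=` [set y | d x0 y <= rho].

Definition lip_with (f : T -> T) (c : R) : Prop :=
  forall x y, d (f x) (f y) <= c * d x y.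

Definition Lip (f : T -> T) : R := inf [set c : R | 0 <= c /\ lip_with f c].

Definition banach_contraction (f : T -> T) : Prop :=
  (exists c : R, lip_with f c) /\ Lip f < 1.

End MetricDefs.

Notation borel d := (g_sigma_algebraType (dopen d)).

Section Measures.
Local Open Scope ereal_scope.
Context {R : realType} {T : pointedType} (d : T -> T -> R).

Definition Pc (mu : set (borel d) -> \bar R) : Prop :=
  [/\ mu set0 = 0,
      (forall A, measurable A -> 0 <= mu A),
      semi_sigma_additive mu,
      mu setT = 1 &
      exists K : set T, dcompact d K /\ mu (~` K) = 0].

Definition push {U : Type} (w : U -> T) (mu : set U -> \bar R) : set T -> \bar R :=
  fun B => mu (w @^-1` B).

Definition markov (L : nat) (phi : 'I_L -> T -> T) (p : 'I_L -> R)
  (mu : set T -> \bar R) : set T -> \bar R :=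
  fun B => \sum_(j < L) (p j)%:E * push (phi j) mu B.

Definition dMK (mu nu : set (borel d) -> \bar R) : \bar R :=
  ereal_sup [set `| integral mu setT (fun x => (f x)%:E)
                   - integral nu setT (fun x => (f x)%:E) |
            | f in [set f : T -> R | forall x y, (`|f x - f y| <= d x y)%R]].

End Measures.

Arguments Pc {R T} d mu.
Arguments dMK {R T} d mu nu.

(* Main.v *)
Require Import Defs.
From HB Require Import structures.
From mathcomp Require Import all_boot all_order all_algebra.
From mathcomp Require Import all_classical all_reals.
From mathcomp Require Import ereal topology normedtype sequences measure lebesgue_integral.
From mathcomp Require Import numfun lebesgue_stieltjes_measure measurable_realfun ring lra.
Import Order.TTheory GRing.Theory Num.Theory.
Import numFieldNormedType.Exports.
Set Implicit Arguments.
Unset Strict Implicit.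
Unset Printing Implicit Defensive.
Local Open Scope classical_set_scope.
Local Open Scope ring_scope.

(** The discretized operator loses at most [eps] per step: replacing [phi j] by
    [r \o phi j] moves points by at most [eps], and composing a 1-Lipschitz test
    function with [phi j] makes it [alpha]-Lipschitz.  Hence
      dMK (e# nu_{n+1}) mu <= eps + alpha * dMK (e# nu_n) mu,
    and [eps / (1 - alpha)] is the fixed point of this affine recursion.  All test
    functions are integrable because a compactly supported measure has a finite
    first moment, a property that the Markov operator preserves. *)

(** * Lipschitz maps, measurability and compact sets for the metric [d] *)

Section metric_borel.
Context {R : realType} {T : pointedType} (d : T -> T -> R).
Hypothesis dm : is_metric d.

Let d_ge0 x y : 0 <= d x y. Proof. by case: dm. Qed.
Let dxx x : d x x = 0. Proof. by case: dm => _ /(_ x x)[_ ->]. Qed.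
Let dC x y : d x y = d y x. Proof. by case: dm. Qed.
Let d_triangle x y z : d x z <= d x y + d y z. Proof. by case: dm. Qed.

Let d_gt0 x y : x <> y -> 0 < d x y.
Proof.
case: dm => _ dxy _ _ xy; rewrite lt_def d_ge0 andbT.
by apply/eqP => /dxy.
Qed.

(** The infimum is attained: for distinct points every admissible constant bounds the quotient of
    distances from above, hence so does the infimum of these constants. *)
Lemma lip_with_Lip (f : T -> T) :
  (exists c, lip_with d f c) -> lip_with d f (Lip d f).
Proof.
move=> [c cP] x y.
have lipmax : [set c | 0 <= c /\ lip_with d f c] (Num.max c 0).
  split; first by rewrite le_max lexx orbT.
  move=> u v; rewrite (le_trans (cP u v))// ler_wpM2r//.
  by rewrite le_max lexx.
have [->|xy] := eqVneq x y; first by rewrite !dxx mulr0.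
have dxy : 0 < d x y by exact/d_gt0/eqP.
rewrite -ler_pdivrMr//; apply: lb_le_inf; first by exists (Num.max c 0).
by move=> k [_ kP]; rewrite ler_pdivrMr.
Qed.

Lemma dopen_measurable (A : set (borel d)) : dopen d A -> measurable A.
Proof. exact: sub_sigma_algebra. Qed.

(** Preimages of open sets are open by continuity, and open sets generate the sigma-algebra of the
    target. *)
Lemma measurable_fun_lipschitz_map (T' : pointedType) (d' : T' -> T' -> R)
    (w : T -> T') (c : R) :
  (forall x y, d' (w x) (w y) <= c * d x y) ->
  measurable_fun setT (w : borel d -> borel d').
Proof.
move=> wc; apply: (@measurability _ _ (borel d) (borel d') setT w (dopen d')) => //.
move=> _ [A oA <-]; rewrite setTI; apply: dopen_measurable => x /oA[eta [eta0 etaA]].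
(* The constant [c] may be zero or negative; its maximum with 1 is a positive Lipschitz constant to
   divide by. *)
have k0 : 0 < Num.max c 1 by rewrite lt_max ltr01 orbT.
exists (eta / Num.max c 1); split; first by rewrite divr_gt0.
move=> y /= xy; apply: etaA => /=; apply: le_lt_trans (wc x y) _.
rewrite (@le_lt_trans _ _ (Num.max c 1 * d x y))//.
  by rewrite ler_wpM2r// le_max lexx.
by rewrite mulrC -ltr_pdivlMr.
Qed.

Lemma measurable_fun_lipschitz (f : T -> R) (c : R) :
  (forall x y, `|f x - f y| <= c * d x y) ->
  measurable_fun setT (f : borel d -> R).
Proof.
move=> fc; apply: (measurability _ (RGenOInfty.measurableE R)).
move=> _ [_ [a ->] <-]; rewrite setTI; apply: dopen_measurable => x /=.
rewrite in_itv/= andbT => ax.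
have k0 : 0 < Num.max c 1 by rewrite lt_max ltr01 orbT.
exists ((f x - a) / Num.max c 1); split; first by rewrite divr_gt0 ?subr_gt0.
move=> y /= xy; rewrite in_itv/= andbT.
have : f x - f y < f x - a.
  apply: le_lt_trans (ler_norm _) _; apply: le_lt_trans (fc x y) _.
  rewrite (@le_lt_trans _ _ (Num.max c 1 * d x y))//.
    by rewrite ler_wpM2r// le_max lexx.
  by rewrite mulrC -ltr_pdivlMr.
lra.
Qed.

Lemma dist_lipschitz x0 x y : `|d x0 x - d x0 y| <= 1 * d x y.
Proof.
rewrite mul1r ler_norml; have := d_triangle x0 x y; have := d_triangle x0 y x.
by rewrite (dC y x) => *; apply/andP; split; lra.
Qed.

(** Balls around [x0] with integer radii cover [K]; the sum of the finitely many radii selected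
    dominates each of them. *)
Lemma dcompact_bounded (K : set T) (x0 : T) : dcompact d K ->
  exists rho : R, forall x, K x -> d x0 x <= rho.
Proof.
move=> /(_ nat (fun n => [set y | d x0 y < n%:R])).
have oU n : dopen d [set y | d x0 y < n%:R].
  move=> y /= yn; exists (n%:R - d x0 y); split; first by rewrite subr_gt0.
  by move=> z /= yz; have := d_triangle x0 y z; lra.
case=> //.
  move=> x _; exists (Num.truncn (d x0 x)).+1 => //=; exact: truncnS_gt.
move=> n [g Kg]; exists (\sum_(k < n) (g k)%:R) => x /Kg[k kn /= /ltW].
move=> /le_trans; apply; rewrite (bigD1 (Ordinal kn))//= lerDl.
by apply: sumr_ge0.
Qed.

(** For [x] outside [K], the complements of the closed balls of radius [1/(n+1)] around [x] cover
    [K]. A ball around [x] no larger than any of the finitely many selected radii then misses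
    [K]. *)
Lemma dcompact_setC_dopen (K : set T) : dcompact d K -> dopen d (~` K).
Proof.
move=> cK x nKx; have := cK nat (fun n => [set y | n.+1%:R^-1 < d x y]).
have oU n : dopen d [set y | n.+1%:R^-1 < d x y].
  move=> y /= yn; exists (d x y - n.+1%:R^-1); split; first by rewrite subr_gt0.
  move=> z /= yz; have := d_triangle x z y; rewrite (dC z y).
  by move: (n.+1%:R^-1) yz => a; lra.
case=> //.
  move=> y Ky; have dxy : 0 < d x y by apply: d_gt0 => xy; apply: nKx; rewrite xy.
  exists (Num.truncn (d x y)^-1) => //=.
  rewrite -[ltRHS]invrK ltf_pV2 ?posrE ?invr_gt0//; exact: truncnS_gt.
move=> n [g Kg]; exists ((\sum_(k < n) (g k).+1)%N.+1%:R^-1); split => //.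
move=> y /= dxy /Kg[k kn /=]; apply/negP; rewrite -leNgt; apply: (le_trans (ltW dxy)).
rewrite lef_pV2 ?posrE// ler_nat (bigD1 (Ordinal kn))//=.
exact/leqW/leq_addr.
Qed.

End metric_borel.

(** * Integrals against bare set functions *)

Section set_function_integral.
Local Open Scope ereal_scope.
Context d (T : measurableType d) (R : realType).
Import HBNNSimple.

(** A simple function is integrated through the values of the set function on its fibres, which are
    measurable. This moves integrals from a bare set function to a genuine measure. *)
Lemma eq_set_function_integral (m1 m2 : set T -> \bar R) (f : T -> \bar R) :
  (forall A, measurable A -> m1 A = m2 A) ->
  integral m1 setT f = integral m2 setT f.
Proof.
move=> m12; rewrite /integral.
have E (h : {nnsfun T >-> R}) : sintegral m1 h = sintegral m2 h.
  by apply: eq_fsbigr => x _; rewrite m12.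
by congr (ereal_sup _ - ereal_sup _); apply: eq_imagel => h _; exact: E.
Qed.

End set_function_integral.

(** * Elements of [Pc] as probability measures *)

Section Pc_probability.
Local Open Scope ereal_scope.
Context {R : realType} {T : pointedType} (d : T -> T -> R).
Variable mu : set (borel d) -> \bar R.
Hypothesis Pmu : Pc d mu.

(* [Pc] does not constrain [mu] on non-measurable sets, whereas MathComp-Analysis
   measures are nonnegative on all sets. *)
Definition Pc_measure (A : set (borel d)) : \bar R :=
  if pselect (measurable A) then mu A else 0.

Lemma Pc_measureE A : measurable A -> Pc_measure A = mu A.
Proof. by rewrite /Pc_measure; case: pselect. Qed.

Let Pc_measure0 : Pc_measure set0 = 0.
Proof. by rewrite Pc_measureE//; case: Pmu. Qed.

Let Pc_measure_ge0 A : 0 <= Pc_measure A.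
Proof. by rewrite /Pc_measure; case: pselect => // mA; case: Pmu => _ ->. Qed.

Let Pc_measure_sigma_additive : semi_sigma_additive Pc_measure.
Proof.
move=> F mF tF mUF; rewrite Pc_measureE//.
under eq_fun do under eq_bigr do rewrite Pc_measureE//.
by case: Pmu => _ _ /(_ F mF tF mUF).
Qed.

HB.instance Definition _ := isMeasure.Build _ _ _ Pc_measure
  Pc_measure0 Pc_measure_ge0 Pc_measure_sigma_additive.

Let Pc_measure_setT : Pc_measure setT = 1.
Proof. by rewrite Pc_measureE//; case: Pmu. Qed.

HB.instance Definition _ := Measure_isProbability.Build _ _ _ Pc_measure
  Pc_measure_setT.

Definition Pc_probability : probability (borel d) R := Pc_measure.
End Pc_probability.

(** * The Markov operator as a mixture of image measures *)

Section mixture.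
Local Open Scope ereal_scope.
Context dd (T : measurableType dd) (R : realType) (L : nat).
Variables (w : 'I_L -> T -> T) (p : 'I_L -> R) (P : probability T R).
Hypothesis mw : forall j, measurable_fun setT (w j).
Hypothesis p_ge0 : forall j, (0 <= p j)%R.
Hypothesis p_sum1 : (\sum_(j < L) p j = 1)%R.

Definition mixture (A : set T) : \bar R :=
  \sum_(j < L) (p j)%:E * P (w j @^-1` A).

Let image_measure (j : 'I_L) : {measure set T -> \bar R} :=
  measure_function_pushforward__canonical__measure_function_Measure P (mw j).

(** [msum] sums a sequence indexed by [nat], so the index is cast back to an ordinal; the zero
    measure is the default from [L] on, outside the range of the sum. *)
Let summand (k : nat) : {measure set T -> \bar R} :=
  if insub k is Some j then mscale (NngNum (p_ge0 j)) (image_measure j)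
  else mzero.

Let mixtureE : mixture = msum summand L.
Proof.
apply/funext => A; rewrite /mixture /msum; apply: eq_bigr => j _.
by rewrite /summand valK.
Qed.

Let mixture0 : mixture set0 = 0. Proof. by rewrite mixtureE measure0. Qed.

Let mixture_ge0 A : 0 <= mixture A. Proof. by rewrite mixtureE. Qed.

Let mixture_sigma_additive : semi_sigma_additive mixture.
Proof. by rewrite mixtureE; exact: measure_semi_sigma_additive. Qed.

HB.instance Definition _ := isMeasure.Build _ _ _ mixture
  mixture0 mixture_ge0 mixture_sigma_additive.

Let mixture_setT : mixture setT = 1.
Proof.
rewrite /mixture; under eq_bigr do rewrite preimage_setT probability_setT mule1.
by rewrite sumEFin p_sum1.
Qed.

HB.instance Definition _ := Measure_isProbability.Build _ _ _ mixture
  mixture_setT.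

Definition mixture_probability : probability T R := mixture.

Lemma ge0_integral_mixture (f : T -> \bar R) : measurable_fun setT f ->
  (forall x, 0 <= f x) ->
  \int[mixture]_x f x = \sum_(j < L) (p j)%:E * \int[P]_x f (w j x).
Proof.
move=> mf f0; rewrite mixtureE ge0_integral_measure_sum//; apply: eq_bigr => j _.
rewrite /summand valK ge0_integral_mscale//=.
by rewrite ge0_integral_pushforward// preimage_setT.
Qed.

Lemma integrable_mixture (f : T -> R) : measurable_fun setT f ->
  (forall j, P.-integrable setT (EFin \o (f \o w j))) ->
  mixture_probability.-integrable setT (EFin \o f).
Proof.
move=> mf intf; apply/integrableP; split; first exact/measurable_EFinP.
rewrite [ltLHS]ge0_integral_mixture//; last first.
  by apply/measurable_EFinP; exact: measurableT_comp.
apply: lte_sum_pinfty => j _; apply: lte_mul_pinfty; rewrite ?lee_fin//.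
by have /integrableP[] := intf j.
Qed.

(** The formula for nonnegative functions is applied to the positive and negative parts of [f].
    Integrability makes all these integrals finite, so their difference can be taken term by
    term. *)
Lemma Rintegral_mixture (f : T -> R) : measurable_fun setT f ->
  (forall j, P.-integrable setT (EFin \o (f \o w j))) ->
  (\int[mixture_probability]_x f x = \sum_(j < L) p j * \int[P]_x f (w j x))%R.
Proof.
move=> mf intf; apply: EFin_inj; rewrite -sumEFin.
rewrite /Rintegral fineK; last exact/integrable_fin_num/integrable_mixture.
have mE : measurable_fun setT (EFin \o f) by exact/measurable_EFinP.
rewrite integralE [X in X - _]ge0_integral_mixture//; last exact: measurable_funepos.
rewrite [X in _ - X]ge0_integral_mixture//; last exact: measurable_funeneg.
have posE j : (fun x => (EFin \o f)^\+ (w j x)) = (EFin \o (f \o w j))^\+.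
  by apply/funext => x; rewrite !funeposE.
have negE j : (fun x => (EFin \o f)^\- (w j x)) = (EFin \o (f \o w j))^\-.
  by apply/funext => x; rewrite !funenegE.
have posfin j : \int[P]_x (EFin \o f)^\+ (w j x) \is a fin_num.
  by rewrite posE; apply: integrable_fin_num => //; exact: integrable_funepos.
have negfin j : \int[P]_x (EFin \o f)^\- (w j x) \is a fin_num.
  by rewrite negE; apply: integrable_fin_num => //; exact: integrable_funeneg.
rewrite -fin_num_sumeN => [|j _]; last by rewrite fin_numM.
rewrite -big_split/=; apply: eq_bigr => j _.
rewrite EFinM fineK; last exact/integrable_fin_num/intf.
rewrite [in RHS]integralE -posE -negE [RHS]muleBr//.
exact: fin_num_adde_defr.
Qed.
End mixture.

(** * Domination and norm bounds for real integrals *)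

Section Rintegral_bounds.
Context dd (T : measurableType dd) (R : realType) (P : probability T R).

Lemma integrable_le_affine (g h : T -> R) (a b : R) :
  measurable_fun setT h -> P.-integrable setT (EFin \o g) ->
  (forall t, `|h t| <= a + b * g t) -> P.-integrable setT (EFin \o h).
Proof.
move=> mh ig hg.
apply: (@le_integrable _ _ _ P _ _ _ ((EFin \o cst a) \+ (fun t => b%:E * (g t)%:E))%E) => //.
- exact/measurable_EFinP.
- by move=> t _; rewrite /= lee_fin (le_trans (hg t))// ler_norm.
- apply: integrableD => //; first exact: finite_measure_integrable_cst.
  exact: integrableZl.
Qed.

Lemma normr_Rintegral_le (g h : T -> R) :
  P.-integrable setT (EFin \o h) -> P.-integrable setT (EFin \o g) ->
  (forall t, `|h t| <= g t) -> `|\int[P]_t h t| <= \int[P]_t g t.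
Proof.
move=> ih ig hg; apply: (le_trans (le_normr_Rintegral _ ih)) => //.
by apply: le_Rintegral => //; exact: integrable_norm.
Qed.

Lemma Rintegral_cst_probability (c : R) : \int[P]_t c = c.
Proof.
by rewrite Rintegral_cst// [fine _](congr1 fine (probability_setT P)) mulr1.
Qed.

Lemma Rintegral_dist_le (g h : T -> R) (c : R) :
  P.-integrable setT (EFin \o g) -> P.-integrable setT (EFin \o h) ->
  (forall t, `|g t - h t| <= c) -> `|\int[P]_t g t - \int[P]_t h t| <= c.
Proof.
move=> ig ih gh; rewrite -RintegralB// -[leRHS]Rintegral_cst_probability.
apply: normr_Rintegral_le => //.
  exact: (integrableB measurableT ig ih).
exact: finite_measure_integrable_cst.
Qed.

End Rintegral_bounds.

(** * Lipschitz test functions, first moments and [dMK] *)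

Section lipschitz_integrals.
Context {R : realType} {X : pointedType} (d : X -> X -> R).
Hypothesis dm : is_metric d.

Definition lipschitz_fun (f : X -> R) (c : R) : Prop :=
  forall x y, `|f x - f y| <= c * d x y.

(** A Lipschitz function grows at most affinely in the distance to [x0], so a finite first moment
    dominates it. *)
Lemma integrable_lipschitz_comp dd (T : measurableType dd)
    (P : probability T R) (u : T -> borel d) (f : X -> R) (c : R) (x0 : X) :
  measurable_fun setT u -> lipschitz_fun f c ->
  P.-integrable setT (EFin \o (fun t => d x0 (u t))) ->
  P.-integrable setT (EFin \o (fun t => f (u t))).
Proof.
move=> mu fc id; apply: (@integrable_le_affine _ _ _ P _ _ `|f x0| c _ id).
  have mf := measurable_fun_lipschitz dm fc.
  exact: (measurableT_comp mf mu).
move=> t; have := fc (u t) x0; case: dm => _ _ dC _; rewrite (dC (u t)).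
by have := ler_normD (f x0) (f (u t) - f x0); rewrite addrC subrK; lra.
Qed.

Lemma integrable_lipschitz (Q : probability (borel d) R) (f : X -> R) (c : R)
    (x0 : X) : lipschitz_fun f c ->
  Q.-integrable setT (EFin \o (fun x => d x0 x)) ->
  Q.-integrable setT (EFin \o f).
Proof.
move=> fc iQ; pose idX : borel d -> borel d := idfun.
exact: (@integrable_lipschitz_comp _ _ Q idX f c x0 (@measurable_id _ _ _) fc iQ).
Qed.

Lemma Pc_integrable_dist (mu : set (borel d) -> \bar R) (Pmu : Pc d mu) (x0 : X) :
  (Pc_probability Pmu).-integrable setT (EFin \o (fun x => d x0 x)).
Proof.
have [_ _ _ _ [K [cK muK]]] := Pmu.
have mK : measurable (~` K : set (borel d)).
  by apply: dopen_measurable; exact: dcompact_setC_dopen.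
have md := measurable_fun_lipschitz dm (dist_lipschitz dm x0).
have mdE : measurable_fun setT (EFin \o (fun x : borel d => d x0 x)).
  exact/measurable_EFinP.
have PK : Pc_probability Pmu (~` K) = 0%E by rewrite [LHS]Pc_measureE.
(* The null complement of [K] is discarded; on the compact [K] the distance to [x0] is bounded. *)
apply/(negligible_integrable mK measurableT mdE PK).
have {}mK : measurable (K : set (borel d)).
  by rewrite -(setCK K); exact: measurableC.
rewrite setTD setCK; apply: measurable_bounded_integrable => //.
- exact: le_lt_trans (probability_le1 _ mK) (ltry _).
- exact: measurable_funTS.
have [rho Krho] := dcompact_bounded dm x0 cK.
exists rho; split; first exact: num_real.
move=> M rhoM x Kx; rewrite /= ger0_norm; last by case: dm.
by rewrite (le_trans (Krho _ Kx))// ltW.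
Qed.

(** Trades the extended-real supremum for real inequalities; [I] and [J] will be real integrals
    against genuine probabilities. *)
Lemma dMK_leP (mu nu : set (borel d) -> \bar R) (I J : (X -> R) -> R) (D : R) :
  (forall f, lipschitz_fun f 1 -> integral mu setT (fun x => (f x)%:E) = (I f)%:E) ->
  (forall f, lipschitz_fun f 1 -> integral nu setT (fun x => (f x)%:E) = (J f)%:E) ->
  (dMK d mu nu <= D%:E)%E <-> forall f, lipschitz_fun f 1 -> `|I f - J f| <= D.
Proof.
move=> hI hJ; split=> [h f f1|h].
  rewrite -lee_fin (le_trans _ h)//; apply: ereal_sup_ubound; exists f => /=.
    by move=> x y; rewrite -[leRHS]mul1r.
  by rewrite hI// hJ.
apply: ge_ereal_sup => _ [f /= f1 <-].
have {}f1 : lipschitz_fun f 1 by move=> x y; rewrite mul1r.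
by rewrite hI// hJ// lee_fin h.
Qed.

Lemma dMK_ge0 (mu nu : set (borel d) -> \bar R) : (0 <= dMK d mu nu)%E.
Proof.
apply: (@le_trans _ _ `|integral mu setT (fun=> 0%:E) - integral nu setT (fun=> 0%:E)|%E).
  exact: abse_ge0.
apply: ereal_sup_ubound; exists (fun=> 0) => //= x y.
by rewrite subrr normr0; case: dm.
Qed.

Section transport.
Context dd (T : measurableType dd) (P : probability T R) (Q : probability (borel d) R).
Variables (u : T -> borel d) (x0 : X).
Hypothesis mu : measurable_fun setT u.
Hypothesis momentP : P.-integrable setT (EFin \o (fun t => d x0 (u t))).
Hypothesis momentQ : Q.-integrable setT (EFin \o (fun x => d x0 x)).

Lemma Rintegral_lipschitz_scale (D c : R) (g : X -> R) :
  (forall f, lipschitz_fun f 1 -> `|\int[P]_t f (u t) - \int[Q]_x f x| <= D) ->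
  0 <= c -> lipschitz_fun g c ->
  `|\int[P]_t g (u t) - \int[Q]_x g x| <= c * D.
Proof.
(* If [c = 0] then [g] is constant and both integrals equal that constant, as both masses are 1.
   Otherwise [g] divided by [c] is a 1-Lipschitz test function. *)
move=> PQ; rewrite le_eqVlt => /predU1P[<- g0|c0 gc].
  have gE x : g x = g x0.
    by apply/eqP; rewrite -subr_eq0 -normr_le0 (le_trans (g0 _ _))// mul0r.
  under eq_Rintegral do rewrite gE.
  under [X in _ - X]eq_Rintegral do rewrite gE.
  by rewrite !Rintegral_cst_probability subrr normr0 mul0r.
have fc : lipschitz_fun (fun x => c^-1 * g x) 1.
  move=> x y; rewrite -mulrBr normrM gtr0_norm ?invr_gt0// mul1r.
  by rewrite mulrC ler_pdivrMr// mulrC.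
have := PQ _ fc; rewrite RintegralZl//; last exact: integrable_lipschitz_comp gc momentP.
rewrite RintegralZl//; last exact: integrable_lipschitz gc momentQ.
rewrite -mulrBr normrM gtr0_norm ?invr_gt0// mulrC ler_pdivrMr//.
by rewrite mulrC.
Qed.

(** Subtracting the constant [f x0] from [f] leaves the difference of integrals unchanged, and what
    remains is at most the distance to [x0]. The bound is uniform in [f], which gives finiteness of
    [dMK]. *)
Lemma Rintegral_lipschitz_moments (f : X -> R) : lipschitz_fun f 1 ->
  `|\int[P]_t f (u t) - \int[Q]_x f x|
  <= \int[P]_t d x0 (u t) + \int[Q]_x d x0 x.
Proof.
move=> f1.
have iP : P.-integrable setT (EFin \o (fun t => f (u t))).
  exact: integrable_lipschitz_comp f1 momentP.
have iQ : Q.-integrable setT (EFin \o f).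
  exact: integrable_lipschitz f1 momentQ.
have cP := finite_measure_integrable_cst P (f x0) measurableT.
have cQ := finite_measure_integrable_cst Q (f x0) measurableT.
have fd x : `|f x - f x0| <= d x0 x.
  by rewrite -[leRHS]mul1r; case: dm => _ _ -> _.
have -> : \int[P]_t f (u t) - \int[Q]_x f x =
    \int[P]_t (f (u t) - f x0) - \int[Q]_x (f x - f x0).
  by rewrite !RintegralB// !Rintegral_cst_probability; ring.
rewrite (le_trans (ler_normB _ _))//; apply: lerD.
  apply: normr_Rintegral_le => //.
  exact: (integrableB measurableT iP cP).
apply: normr_Rintegral_le => //.
exact: (integrableB measurableT iQ cQ).
Qed.
End transport.
End lipschitz_integrals.

(** * One step of the discretized operator, then its iterates *)

Section discretized_markov.
Context {R : realType} {X Xh : pointedType} (d : X -> X -> R) (e : Xh -> X).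
Hypothesis dm : is_metric d.
Let dh (y z : Xh) : R := d (e y) (e z).
Variables (L : nat) (phi : 'I_L -> X -> X) (p : 'I_L -> R) (r : X -> Xh).
Variables (alpha eps : R).
Hypothesis alpha_ge0 : 0 <= alpha.
Hypothesis phi_lip : forall j, lip_with d (phi j) alpha.
Hypothesis p_ge0 : forall j, 0 <= p j.
Hypothesis p_sum1 : \sum_(j < L) p j = 1.
Hypothesis me : measurable_fun setT (e : borel dh -> borel d).
Hypothesis mr : measurable_fun setT (r : borel d -> borel dh).
Hypothesis r_proj : forall x, d x (e (r x)) <= eps.

Let phih (j : 'I_L) (y : Xh) : Xh := r (phi j (e y)).

Let mphi j : measurable_fun setT (phi j : borel d -> borel d).
Proof. exact: measurable_fun_lipschitz_map (phi_lip j). Qed.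

Let mphih j : measurable_fun setT (phih j : borel dh -> borel dh).
Proof. exact: (measurableT_comp mr (measurableT_comp (mphi j) me)). Qed.

Lemma lipschitz_fun_comp_phi (f : X -> R) j :
  lipschitz_fun d f 1 -> lipschitz_fun d (f \o phi j) alpha.
Proof.
move=> f1 x y; apply: le_trans (phi_lip j x y).
by rewrite -[leRHS]mul1r; exact: f1.
Qed.

Section step.
Variables (P : probability (borel dh) R) (x0 : X).
Hypothesis momentP :
  P.-integrable setT (EFin \o (fun y => d x0 (e y))).

Let integrable_phih (f : X -> R) j : lipschitz_fun d f 1 ->
  P.-integrable setT (EFin \o (fun y => f (e (phih j y)))).
Proof.
(* [C] collects the constants of the path from [x0] through [phi j x0] and [phi j (e y)] to
   [e (phih j y)]; the middle leg contributes [alpha * d x0 (e y)]. *)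
move=> f1; pose C := `|f x0| + eps + d x0 (phi j x0).
apply: (@integrable_le_affine _ _ _ P _ _ C alpha _ momentP).
  have mf := measurable_fun_lipschitz dm f1.
  exact: (measurableT_comp mf (measurableT_comp me (mphih j))).
move=> y; have [_ _ dC dT] := dm.
have := f1 (e (phih j y)) x0; rewrite mul1r (dC _ x0).
have := ler_normD (f x0) (f (e (phih j y)) - f x0); rewrite addrC subrK.
have := dT x0 (phi j (e y)) (e (phih j y)); have := r_proj (phi j (e y)).
have := dT x0 (phi j x0) (phi j (e y)); have := phi_lip j x0 (e y).
rewrite /C /phih; lra.
Qed.

Let Q := mixture_probability P mphih p_ge0 p_sum1.

Lemma integrable_dist_step :
  Q.-integrable setT (EFin \o (fun y => d x0 (e y))).
Proof.
have d1 := dist_lipschitz dm x0; apply: integrable_mixture.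
  by have md := measurable_fun_lipschitz dm d1; exact: (measurableT_comp md me).
by move=> j; exact: integrable_phih.
Qed.

Variable (M : probability (borel d) R).
Hypothesis momentM : M.-integrable setT (EFin \o (fun x => d x0 x)).
Hypothesis M_inv : forall A : set (borel d), measurable A -> markov phi p M A = M A.

Lemma Rintegral_invariant (f : X -> R) : lipschitz_fun d f 1 ->
  \int[M]_x f x = \sum_(j < L) p j * \int[M]_x f (phi j x).
Proof.
move=> f1.
have -> : \int[M]_x f x = \int[mixture_probability M mphi p_ge0 p_sum1]_x f x.
  by congr fine; apply: eq_set_function_integral => A mA; exact/esym/M_inv.
rewrite Rintegral_mixture//; first exact: measurable_fun_lipschitz f1.
move=> j; apply: (integrable_lipschitz dm _ momentM).
exact: lipschitz_fun_comp_phi f1.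
Qed.

Lemma Rintegral_step (D : R) :
  (forall f, lipschitz_fun d f 1 -> `|\int[P]_y f (e y) - \int[M]_x f x| <= D) ->
  forall f, lipschitz_fun d f 1 ->
    `|\int[Q]_y f (e y) - \int[M]_x f x| <= eps + alpha * D.
Proof.
move=> PM f f1; rewrite Rintegral_invariant// Rintegral_mixture; last 2 first.
- have mf := measurable_fun_lipschitz dm f1; exact: (measurableT_comp mf me).
- by move=> j; exact: integrable_phih.
(* As the weights sum to 1, the bound becomes a weighted sum and can be checked for each [j]. *)
rewrite -sumrB -[leRHS]mul1r -p_sum1 mulr_suml.
apply: (le_trans (ler_norm_sum _ _ _)); apply: ler_sum => j _.
rewrite -mulrBr normrM ger0_norm// ler_wpM2l//.
have fphi := lipschitz_fun_comp_phi j f1.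
(* The integral of [f (phi j (e y))] is inserted in between: the projection costs at most [eps], and
   the rest is the hypothesis scaled to the [alpha]-Lipschitz function [f \o phi j]. *)
rewrite (le_trans (ler_distD (\int[P]_y f (phi j (e y))) _ _))// lerD//.
  apply: Rintegral_dist_le.
  - exact: integrable_phih.
  - exact: (integrable_lipschitz_comp dm me fphi momentP).
  move=> y; have [_ _ dC _] := dm; rewrite (le_trans (f1 _ _))// mul1r dC.
  exact: r_proj.
exact: (Rintegral_lipschitz_scale dm me momentP momentM PM alpha_ge0 fphi).
Qed.
End step.

Lemma integral_push (m : set (borel dh) -> \bar R) (P : probability (borel dh) R)
    (x0 : X) (f : X -> R) :
  (forall A, measurable A -> P A = m A) ->
  P.-integrable setT (EFin \o (fun y => d x0 (e y))) -> lipschitz_fun d f 1 ->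
  integral (push e m : set (borel d) -> \bar R) setT (fun x => (f x)%:E) =
  (\int[P]_y f (e y))%:E.
Proof.
move=> Pm momentP f1.
have fe := integrable_lipschitz_comp dm me f1 momentP.
rewrite (@eq_set_function_integral _ (borel d) _ _
  (pushforward P (e : borel dh -> borel d))); last first.
  by move=> A mA; rewrite /push /pushforward Pm// -[X in measurable X]setTI; exact: me.
rewrite /Rintegral fineK; last exact: integrable_fin_num.
have mf : measurable_fun setT (EFin \o (f : borel d -> R)).
  by apply/measurable_EFinP; exact: measurable_fun_lipschitz f1.
by rewrite integral_pushforward.
Qed.

(** The iterate is only a set function, so the induction carries a probability agreeing with it on
    measurable sets, together with the finite first moment that the next step requires. *)
Lemma iter_markov_probability (M : probability (borel d) R)
    (nu : set (borel dh) -> \bar R) (P : probability (borel dh) R) (x0 : X) (D : R)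
    (n : nat) :
  alpha < 1 ->
  M.-integrable setT (EFin \o (fun x => d x0 x)) ->
  (forall A : set (borel d), measurable A -> markov phi p M A = M A) ->
  (forall A, measurable A -> P A = nu A) ->
  P.-integrable setT (EFin \o (fun y => d x0 (e y))) ->
  (forall f, lipschitz_fun d f 1 -> `|\int[P]_y f (e y) - \int[M]_x f x| <= D) ->
  0 <= eps ->
  exists Pn : probability (borel dh) R,
    [/\ forall A, measurable A -> Pn A = iter n (markov phih p) nu A,
        Pn.-integrable setT (EFin \o (fun y => d x0 (e y))) &
        forall f, lipschitz_fun d f 1 ->
          `|\int[Pn]_y f (e y) - \int[M]_x f x|
          <= eps / (1 - alpha) + alpha ^+ n * D].
Proof.
move=> alpha1 momentM M_inv Pnu momentP PM eps0.
have alpha1' : 0 < 1 - alpha by rewrite subr_gt0.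
elim: n => [|n [Pn [PnE momentPn PnM]]].
  exists P; split => // f f1; rewrite expr0 mul1r (le_trans (PM f f1))// lerDr.
  by rewrite divr_ge0// ltW.
exists (mixture_probability Pn mphih p_ge0 p_sum1); split.
- move=> A mA; apply: eq_bigr => j _; rewrite /push PnE//.
  by rewrite -[X in measurable X]setTI; exact: mphih.
- exact: integrable_dist_step.
- move=> f f1.
  (* [eps / (1 - alpha)] is the fixed point of [t |-> eps + alpha * t] *)
  have -> : eps / (1 - alpha) + alpha ^+ n.+1 * D =
      eps + alpha * (eps / (1 - alpha) + alpha ^+ n * D).
    by rewrite exprS; field; rewrite gt_eqF.
  exact: (Rintegral_step momentPn momentM M_inv PnM f1).
Qed.

End discretized_markov.

(** * The error bound for the iterates and its limiting form *)

Theorem theorem4p3 (R : realType) (X : pointedType) (d : X -> X -> R)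
  (L : nat) (phi : 'I_L -> X -> X) (p : 'I_L -> R)
  (Xh : pointedType) (e : Xh -> X) (eps : R) (r : X -> Xh)
  (mu : set (borel d) -> \bar R) (nu : set (borel (fun y z : Xh => d (e y) (e z))) -> \bar R) :
  is_metric d -> d_complete d ->
  (forall j, banach_contraction d (phi j)) ->
  (forall j, 0 < p j) -> \sum_(j < L) p j = 1 ->
  0 < eps ->
  (* Xh is a subset of X, with inclusion e *)
  injective e ->
  (* Xh is an eps-net *)
  (forall x : X, exists y : Xh, d x (e y) <= eps) ->
  (* Xh is proper *)
  (forall D : set X, dbounded d D -> finite_set (e @^-1` D)) ->
  (* r is a Borel measurable eps-projection *)
  measurable_fun setT
    (r : borel d -> borel (fun y z : Xh => d (e y) (e z))) ->
  (forall y : Xh, r (e y) = y) ->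
  (forall x : X, d x (e (r x)) <= eps) ->
  (* mu is the Hutchinson measure of S *)
  Pc d mu ->
  (forall A : set (borel d), measurable A -> markov phi p mu A = mu A) ->
  (* nu in P(Xh) *)
  Pc (fun y z : Xh => d (e y) (e z)) nu ->
  let alpha := \big[Num.max/0]_(j < L) Lip d (phi j) in
  let phih := fun (j : 'I_L) (y : Xh) => r (phi j (e y)) in
  (forall n : nat,
     dMK d (push e (iter n (markov phih p) nu)) mu
     <= (eps / (1 - alpha))%:E + (alpha ^+ n)%:E * dMK d (push e nu) mu)%E /\
  (exists n0 : nat, forall n : nat, (n0 <= n)%N ->
     (dMK d (push e (iter n (markov phih p) nu)) mu
      <= (2 * eps / (1 - alpha))%:E)%E).
Proof.
move=> dm _ phic p0 p1 eps0 einj _ _ mr _ r_proj Pmu mu_inv Pnu alpha phih.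
set dh := (fun y z : Xh => d (e y) (e z)) in nu mr Pnu *.
have dhm : is_metric dh.
  case: dm => d0 dxy dC dT; split.
  - by move=> x y; exact: d0.
  - by move=> x y; split=> [/dxy/einj//|->]; exact/dxy.
  - by move=> x y; exact: dC.
  - by move=> x y z; exact: dT.
(* The inclusion is an isometry for the induced metric [dh]. *)
have me : measurable_fun setT (e : borel dh -> borel d).
  by apply: (measurable_fun_lipschitz_map dhm (c := 1)) => x y; rewrite mul1r.
have alpha_ge0 : 0 <= alpha by exact: bigmax_ge_id.
have alpha_lt1 : alpha < 1.
  rewrite /alpha; elim/big_ind: _ => // [x y x1 y1|j _]; first by rewrite gt_max x1.
  by case: (phic j).
have phi_lip j : lip_with d (phi j) alpha.
  move=> x y; have [exc _] := phic j; rewrite (le_trans (lip_with_Lip dm exc x y))//.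
  by apply: ler_wpM2r; [case: dm|rewrite /alpha; exact: le_bigmax].
have p_ge0 j : 0 <= p j by rewrite ltW.
pose M := Pc_probability Pmu; pose P := Pc_probability Pnu.
(* With a base point in the image of [e], the first moment of [nu] for [dh] is literally the moment
   of [d x0 (e y)]. *)
pose x0 : X := e point.
have ME A : measurable A -> M A = mu A by exact: Pc_measureE.
have PE A : measurable A -> P A = nu A by exact: Pc_measureE.
have momentM : M.-integrable setT (EFin \o (fun x => d x0 x)).
  exact: Pc_integrable_dist.
have momentP : P.-integrable setT (EFin \o (fun y => d x0 (e y))).
  exact: (Pc_integrable_dist dhm Pnu point).
have M_inv (A : set (borel d)) : measurable A -> markov phi p M A = M A.
  move=> mA; rewrite ME// -mu_inv//; apply: eq_bigr => j _; congr *%E; apply: ME.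
  rewrite -[X in measurable X]setTI.
  by have := measurable_fun_lipschitz_map dm (phi_lip j); exact.
have intM f : lipschitz_fun d f 1 ->
    integral mu setT (fun x => (f x)%:E) = (\int[M]_x f x)%:E.
  move=> f1; rewrite /Rintegral fineK.
    by apply: eq_set_function_integral => A mA; exact/esym/ME.
  by apply: integrable_fin_num => //; exact: integrable_lipschitz f1 momentM.
have intP := integral_push dm me PE momentP.
(* Finiteness of the initial distance lets the recursion run in [R]. *)
have dMK_fin : dMK d (push e nu) mu \is a fin_num.
  rewrite ge0_fin_numE ?dMK_ge0//.
  apply: (@le_lt_trans _ _ (\int[P]_y d x0 (e y) + \int[M]_x d x0 x)%:E); last exact: ltry.
  by apply/(dMK_leP _ intP intM) => f; exact: Rintegral_lipschitz_moments.
pose D := fine (dMK d (push e nu) mu).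
have DE : dMK d (push e nu) mu = D%:E by rewrite fineK.
have PM : forall f, lipschitz_fun d f 1 -> `|\int[P]_y f (e y) - \int[M]_x f x| <= D.
  by apply/(dMK_leP D intP intM); rewrite DE.
have bound n : (dMK d (push e (iter n (markov phih p) nu)) mu
    <= (eps / (1 - alpha) + alpha ^+ n * D)%:E)%E.
  have [Pn [PnE momentPn PnM]] := iter_markov_probability dm alpha_ge0 phi_lip
    p_ge0 p1 me mr r_proj n alpha_lt1 momentM M_inv PE momentP PM (ltW eps0).
  have intPn := integral_push dm me PnE momentPn.
  by apply/(dMK_leP _ intPn intM).
split=> [n|]; first by rewrite DE -EFinM -EFinD.
have B0 : 0 < eps / (1 - alpha) by rewrite divr_gt0// subr_gt0.
(* The geometric term tends to 0, so it eventually falls below the other summand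
   [eps / (1 - alpha)], which yields the factor 2. *)
have : (fun n => alpha ^+ n * D) @ \oo --> 0.
  rewrite -(mul0r D); apply: cvgM; last exact: cvg_cst.
  by apply: cvg_expr; rewrite ger0_norm.
move=> /cvgr_lt/(_ _ B0)[n0 _ n0P]; exists n0 => n /n0P /= nB.
apply: (le_trans (bound n)); rewrite lee_fin.
by rewrite -mulrA mulr_natl mulr2n lerD2l ltW.
Qed.
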